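(* Let $k\ge 1$. For all integers $0\le r\le m\le n$ with $m\geq 1$, $$\dim S^{r}(\mathbb{C}^{k}\otimes\mathbb{C}^{m})^{S_{m}}=\dim S^{r}(\mathbb{C}^{k}\otimes\mathbb{C}^{n})^{S_{n}},$$ and, as formal power series in $q$, $$1+\sum_{n=1}^{\infty}\dim S^{n}(\mathbb{C}^{k}\otimes\mathbb{C}^{n})^{S_{n}}\,q^{n}=\prod_{r=1}^{\infty}\frac{1}{(1-q^{r})^{\binom{r+k-1}{k-1}}}.$$
   Context: $S^r(W)$ denotes the $r$-th symmetric power of a vector space $W$. The symmetric group $S_n$ acts on $\mathbb{C}^n$ by permuting the standard basis and on $\mathbb{C}^k\otimes\mathbb{C}^n$ by $s\mapsto I\otimes s$; this induces an action on $S^r(\mathbb{C}^k\otimes\mathbb{C}^n)$. $M^{S_n}$ denotes the space of $S_n$-invariants of an $S_n$-module $M$. *)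

(* Defs.v *)
From HB Require Import structures.
From mathcomp Require Import all_boot all_order all_algebra all_fingroup.
From mathcomp Require Import boolp reals complex mxtens.
From mathcomp Require Import mpoly.

Set Implicit Arguments.
Unset Strict Implicit.
Unset Printing Implicit Defensive.

Import GRing.Theory.
Local Open Scope ring_scope.

(** * Symmetric powers *)

(** [sympow F N r] is S^r(F^N), realised as the homogeneous polynomials of
    degree r in the standard basis vectors 'X_0, ..., 'X_(N-1) of F^N; the
    symmetric product of vectors is the product of polynomials.  It is an alias
    of [dhomog N F r], whose [vectType] instance only covers N of the form
    n.+1. *)
Definition sympow (F : fieldType) (N r : nat) : Type := dhomog N F r.

HB.instance Definition _ (F : fieldType) (N r : nat) :=
  GRing.Lmodule.copy (sympow F N r) (dhomog N F r).

Section SymPowVect.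
Variables (F : fieldType) (N r : nat).

Definition mono_of_deg := {m : 'X_{1..N < r.+1} | mdeg m == r}.

Definition sympow_coefs (p : sympow F N r) : 'rV[F]_#|{: mono_of_deg}| :=
  \row_(i < #|{: mono_of_deg}|)
    (p : dhomog N F r)@_(val (val (@enum_val _ {: mono_of_deg} i))).

Lemma sympow_coefs_linear : linear sympow_coefs.
Proof. by move=> a p q; apply/rowP => i; rewrite !mxE /= mcoeffD mcoeffZ. Qed.

Lemma sum_mono_homog (v : 'rV[F]_#|{: mono_of_deg}|) :
  \sum_i v 0 i *: 'X_[val (val (@enum_val _ {: mono_of_deg} i))] \is r.-homog.
Proof.
apply: rpred_sum => i _; apply: rpredZ; rewrite dhomogX.
exact: (valP (enum_val i)).
Qed.

Lemma sympow_coefs_bij : bijective sympow_coefs.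
Proof.
exists (fun v => DHomog (sum_mono_homog v) : sympow F N r) => [p|v].
  apply: val_inj; apply/mpolyP => m /=; rewrite raddf_sum /=.
  have [dm|ndm] := eqVneq (mdeg m) r; last first.
    rewrite (dhomog_nemf_coeff (dhomog_is_dhomog p) ndm) big1 // => i _.
    rewrite mcoeffZ mcoeffX; case: eqP => [E|_]; last by rewrite mulr0.
    by case/negP: ndm; rewrite -E; exact: (valP (enum_val i)).
  have lm : (mdeg m < r.+1)%N by rewrite dm.
  have dm' : mdeg (BMultinom lm) == r by apply/eqP.
  pose x : mono_of_deg := exist _ (BMultinom lm) dm'.
  rewrite (bigD1 (enum_rank x)) //= mcoeffZ mcoeffX mxE enum_rankK eqxx mulr1.
  rewrite big1 ?addr0 // => i nei; rewrite mcoeffZ mcoeffX.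
  case: eqP => [E|_]; last by rewrite mulr0.
  case/eqP: nei; apply: enum_val_inj; rewrite enum_rankK.
  by apply/val_inj/val_inj.
apply/rowP => j; rewrite mxE /= raddf_sum /= (bigD1 j) //= big1 => [|i nei].
  by rewrite mcoeffZ mcoeffX eqxx mulr1 addr0.
rewrite mcoeffZ mcoeffX; case: eqP => [E|_]; last by rewrite mulr0.
by case/eqP: nei; apply/enum_val_inj/val_inj/val_inj.
Qed.

Lemma sympow_vecaxiom : vector_axiom #|{: mono_of_deg}| (sympow F N r).
Proof. by exists sympow_coefs; [exact: sympow_coefs_linear|exact: sympow_coefs_bij]. Qed.

HB.instance Definition _ :=
  Lmodule_hasFinDim.Build F (sympow F N r) sympow_vecaxiom.

End SymPowVect.

(** The embedding of F^N as the linear forms. *)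
Definition symvec (F : fieldType) (N : nat) (v : 'rV[F]_N) : {mpoly F[N]} :=
  \sum_j v 0 j *: 'X_j.

(** The algebra endomorphism of S(F^N) induced by the endomorphism v |-> v *m A
    of F^N: it sends the i-th basis vector to the i-th row of A. *)
Definition symsubst (F : fieldType) (N : nat) (A : 'M[F]_N)
    (p : {mpoly F[N]}) : {mpoly F[N]} :=
  p \mPo [tuple symvec (row i A) | i < N].

Section SymPowMap.
Variables (F : fieldType) (N r : nat) (A : 'M[F]_N).

Lemma symsubst_symvec (v : 'rV[F]_N) : symsubst A (symvec v) = symvec (v *m A).
Proof.
rewrite /symsubst /symvec raddf_sum /=.
under eq_bigr => i _ do rewrite comp_mpolyZ comp_mpolyXU -tnth_nth tnth_mktuple
  /symvec scaler_sumr.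
rewrite exchange_big /=; apply: eq_bigr => j _; rewrite mxE scaler_suml.
by apply: eq_bigr => i _; rewrite mxE scalerA.
Qed.

Lemma symsubst_homog (p : {mpoly F[N]}) :
  p \is r.-homog -> symsubst A p \is r.-homog.
Proof.
move=> hp; rewrite /symsubst comp_mpolyE big_seq; apply: rpred_sum => m hm.
apply: rpredZ; rewrite -(dhomog_mf hp hm) /= mdegE.
elim/big_rec2: _ => [|i d q _ hq]; first exact: dhomog1.
apply: dhomogM => //; rewrite tnth_mktuple.
have h1 : symvec (row i A) \is 1.-homog.
  by apply: rpred_sum => j _; apply: rpredZ; rewrite dhomogX /= mdeg1.
by have := dhomogMn (m i) h1; rewrite mul1n.
Qed.

Definition sympow_fun (p : sympow F N r) : sympow F N r :=
  DHomog (symsubst_homog (dhomog_is_dhomog p)).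

Lemma sympow_fun_linear : linear sympow_fun.
Proof.
by move=> a p q; apply: val_inj; rewrite /= /symsubst comp_mpolyD comp_mpolyZ.
Qed.

HB.instance Definition _ :=
  GRing.isLinear.Build F (sympow F N r) (sympow F N r) _ sympow_fun
    sympow_fun_linear.

(** S^r(A), for the endomorphism v |-> v *m A of F^N. *)
Definition sympow_mx : 'End(sympow F N r) := linfun sympow_fun.

Lemma sympow_mxE (p : sympow F N r) :
  mpoly_of_dhomog (sympow_mx p) = symsubst A (mpoly_of_dhomog p).
Proof. by rewrite lfunE. Qed.

End SymPowMap.

(** S^r(F^k (x) F^n)^(S_n).  The space F^k (x) F^n is F^(k * n) via the
    Kronecker product, and s acts on it by I (x) s, where s maps the i-th basis
    vector of F^n to the (s i)-th one ([perm_mx s] acting on row vectors). *)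
Definition sympow_inv (F : fieldType) (k n r : nat) :
    {vspace sympow F (k * n) r} :=
  (\bigcap_(s : 'S_n) fixedSpace (sympow_mx r (1%:M *t perm_mx s)))%VS.

(** * Formal power series *)

Record fps (R : Type) := FPS { fps_coef :> nat -> R }.

Lemma fpsP (R : Type) (f g : fps R) : (forall n, f n = g n) -> f = g.
Proof. by case: f g => [f] [g] /= /funext ->. Qed.

HB.instance Definition _ (R : Type) := gen_eqMixin (fps R).
HB.instance Definition _ (R : Type) := gen_choiceMixin (fps R).

Section FpsRing.
Variable R : comNzRingType.
Implicit Types f g h : fps R.

Definition fps_zero : fps R := FPS (fun _ => 0).
Definition fps_opp f : fps R := FPS (fun n => - f n).
Definition fps_add f g : fps R := FPS (fun n => f n + g n).

Fact fps_addA : associative fps_add.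
Proof. by move=> f g h; apply: fpsP => n /=; rewrite addrA. Qed.
Fact fps_addC : commutative fps_add.
Proof. by move=> f g; apply: fpsP => n /=; rewrite addrC. Qed.
Fact fps_add0 : left_id fps_zero fps_add.
Proof. by move=> f; apply: fpsP => n /=; rewrite add0r. Qed.
Fact fps_addN : left_inverse fps_zero fps_opp fps_add.
Proof. by move=> f; apply: fpsP => n /=; rewrite addNr. Qed.

HB.instance Definition _ :=
  GRing.isZmodule.Build (fps R) fps_addA fps_addC fps_add0 fps_addN.

Definition fps_one : fps R := FPS (fun n => (n == 0%N)%:R).
Definition fps_mul f g : fps R :=
  FPS (fun n => \sum_(i < n.+1) f i * g (n - i)%N).

Let trunc m f : {poly R} := \poly_(i < m.+1) f i.

Let coef_trunc m f n : (n <= m)%N -> (trunc m f)`_n = f n.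
Proof. by move=> le; rewrite coef_poly ltnS le. Qed.

Let fps_mulE m f g n : (n <= m)%N ->
  fps_mul f g n = (trunc m f * trunc m g)`_n.
Proof.
move=> le; rewrite coefM; apply: eq_bigr => i _.
by rewrite !coef_trunc // (leq_trans _ le) ?leq_subr // -ltnS.
Qed.

Fact fps_mulC : commutative fps_mul.
Proof.
by move=> f g; apply: fpsP => n; rewrite !(@fps_mulE n) // mulrC.
Qed.

Fact fps_mulA : associative fps_mul.
Proof.
move=> f g h; apply: fpsP => n.
transitivity (trunc n f * (trunc n g * trunc n h))`_n.
  rewrite coefM; apply: eq_bigr => i _.
  by rewrite (@fps_mulE n) ?leq_subr // coef_trunc // -ltnS.
rewrite mulrA coefM; apply: eq_bigr => i _.
have le : (i <= n)%N by rewrite -ltnS.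
by rewrite (@fps_mulE n _ _ i) // coef_trunc // leq_subr.
Qed.

Fact fps_mul1 : left_id fps_one fps_mul.
Proof.
move=> f; apply: fpsP => n /=; rewrite big_ord_recl /= mul1r subn0 big1 ?addr0 //.
by move=> i _; rewrite mul0r.
Qed.

Fact fps_mulDl : left_distributive fps_mul fps_add.
Proof.
move=> f g h; apply: fpsP => n /=; rewrite -big_split /=.
by apply: eq_bigr => i _; rewrite mulrDl.
Qed.

Fact fps_one_neq0 : fps_one != 0 :> fps R.
Proof.
apply/eqP => /(congr1 (fun f : fps R => f 0%N)) /= /eqP.
by rewrite oner_eq0.
Qed.

HB.instance Definition _ := GRing.Zmodule_isComNzRing.Build (fps R)
  fps_mulA fps_mulC fps_mul1 fps_mulDl fps_one_neq0.

Definition fps_unit : pred (fps R) := fun f => `[< exists g, g * f = 1 >].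

(** Non-units are their own inverse, as usual in a [unitRingType]; the series
    1 - q^r with 0 < r are units ([fps_unit_1subqX]). *)
Definition fps_inv f : fps R :=
  if pselect (exists g, g * f = 1) is left ex then projT1 (cid ex) else f.

Fact fps_mulVf : {in fps_unit, left_inverse 1 fps_inv *%R}.
Proof.
move=> f; rewrite unfold_in /fps_inv => /asboolP ex.
by case: pselect => // ex'; case: cid.
Qed.

Fact fps_unitP f g : g * f = 1 -> fps_unit f.
Proof. by move=> gf; apply/asboolP; exists g. Qed.

Fact fps_inv_out : {in [predC fps_unit], fps_inv =1 id}.
Proof.
move=> f /negP nu; rewrite /fps_inv; case: pselect => // ex.
by case: nu; apply/asboolP.
Qed.

HB.instance Definition _ := GRing.ComNzRing_hasMulInverse.Build (fps R)
  fps_mulVf fps_unitP fps_inv_out.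

(** The indeterminate q. *)
Definition fpsq : fps R := FPS (fun n => (n == 1%N)%:R).

Lemma fps_coefB f g n : (f - g) n = f n - g n.
Proof. by []. Qed.

Lemma fps_coefM f g n : (f * g) n = \sum_(i < n.+1) f i * g (n - i)%N.
Proof. by []. Qed.

Lemma fpsqXE r n : (fpsq ^+ r) n = (n == r)%:R.
Proof.
elim: r n => [|r IH] n; first by rewrite expr0.
rewrite exprS fps_coefM big_ord_recl mul0r add0r.
case: n => [|n]; first by rewrite big_ord0.
rewrite big_ord_recl big1 => [|i _]; last by rewrite mul0r.
by rewrite mul1r addr0 IH subn1.
Qed.

Lemma fps_unit_1subqX r : (0 < r)%N -> (1 - fpsq ^+ r) \is a GRing.unit.
Proof.
move=> r0; pose g : fps R := FPS (fun n => (r %| n)%:R).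
have qg n : (fpsq ^+ r * g) n = ((r <= n)%N && (r %| n)%N)%:R.
  rewrite fps_coefM; have [le|lt] := leqP r n; last first.
    rewrite big1 // => i _; rewrite fpsqXE ltn_eqF ?mul0r //.
    exact: leq_trans (ltn_ord i) lt.
  pose r' := Ordinal (le : r < n.+1)%N.
  rewrite (bigD1 r') //= fpsqXE eqxx mul1r big1 => [|i ne].
    by rewrite addr0 dvdn_subl.
  by rewrite fpsqXE -[_ == r]/(i == r') (negPf ne) mul0r.
suff gK : (1 - fpsq ^+ r) * g = 1.
  by apply/unitrP; exists g; rewrite mulrC.
apply: fpsP => n; rewrite mulrBl mul1r fps_coefB qg /=.
case: n => [|n]; first by rewrite dvdn0 leqNgt r0 subr0.
have [dv|_] := boolP (r %| n.+1)%N; last by rewrite andbF subrr.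
by rewrite dvdn_leq // subrr.
Qed.

End FpsRing.

Notation "''q'" := (fpsq _) : ring_scope.

(** [l] is the infinite product [u 1 * u 2 * ...]: each coefficient of the
    partial products is eventually that of [l]. *)
Definition fps_infprod (R : comNzRingType) (u : nat -> fps R) (l : fps R) :=
  forall n, exists M, forall m, (M <= m)%N ->
    (\prod_(1 <= r < m.+1) u r) n = l n.

(* Main.v *)
(** A monomial in the variables x_(i,j), i < k, j < n, is the sequence of its n
    columns, which are vectors in N^k, and S_n permutes the columns.  The
    invariants of degree r are thus the functions on multisets of n vectors in
    N^k of total size r.  When r <= n the zero vectors only pad such a multiset,
    so the dimension is the number of multisets of nonzero vectors of total
    size r, whatever n.  The generating function of the latter is the product of
    1 / (1 - q^|v|) over all nonzero v, and C(r + k - 1, k - 1) of them have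
    size r. *)
Require Import Defs.
From HB Require Import structures.
From mathcomp Require Import all_boot all_order all_algebra all_fingroup.
From mathcomp Require Import reals complex.
From mathcomp Require Import mxtens mpoly.

Set Implicit Arguments.
Unset Strict Implicit.
Unset Printing Implicit Defensive.

Import GRing.Theory.
Local Open Scope ring_scope.

(** Multisets of elements of [V] of total weight [n], given by multiplicities;
    bounding these by [n] loses nothing when all weights are positive. *)
Definition wpart {V : finType} (w : V -> nat) (n : nat) :
    {set {ffun V -> 'I_n.+1}} :=
  [set c : {ffun V -> 'I_n.+1} | \sum_v c v * w v == n]%N.

(** The nonzero vectors of N^k; the size bound makes the type finite and excludes nothing from a
    multiset of total size [n]. *)
Definition posmnm (k n : nat) := {v : 'X_{1..k < n.+1} | (0 < mdeg v)%N}.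

(** * Truncated power series and the generating function of weighted multisets *)

Section Series.
Variable R : comNzRingType.
Implicit Types f g h : fps R.

(** Congruence modulo q^(N+1). *)
Definition fps_eqmod (N : nat) f g := forall n, (n <= N)%N -> f n = g n.

Lemma fps_eqmodM N f f' g g' :
  fps_eqmod N f f' -> fps_eqmod N g g' -> fps_eqmod N (f * g) (f' * g').
Proof.
move=> ff gg n le; rewrite !fps_coefM; apply: eq_bigr => i _.
rewrite ff ?gg // ?(leq_trans (leq_subr _ _) le) //.
by rewrite (leq_trans _ le) // -ltnS.
Qed.

Lemma fps_eqmod_prod1 N (I : Type) (s : seq I) (P : pred I) (F : I -> fps R) :
  (forall i, P i -> fps_eqmod N (F i) 1) ->
  fps_eqmod N (\prod_(i <- s | P i) F i) 1.
Proof.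
move=> F1; elim/big_ind: _ => // f g f1 g1 n le.
by rewrite (fps_eqmodM f1 g1) // mulr1.
Qed.

Lemma fps_eqmod_1subqX N r : (N < r)%N -> fps_eqmod N (1 - 'q ^+ r) 1.
Proof.
move=> lt n le; rewrite fps_coefB fpsqXE ltn_eqF ?subr0 //.
exact: leq_ltn_trans le lt.
Qed.

Lemma fps_eqmod_inv N f g : g * f = 1 -> fps_eqmod N f 1 -> fps_eqmod N g 1.
Proof.
move=> gf f1 n le; rewrite -gf -[in LHS](mulr1 g).
by apply: (@fps_eqmodM N) => // m lm; rewrite f1.
Qed.

Lemma fps_coef_sum (I : Type) (s : seq I) (P : pred I) (F : I -> fps R) n :
  (\sum_(i <- s | P i) F i) n = \sum_(i <- s | P i) F i n.
Proof. by apply: (big_morph (fun f : fps R => f n)). Qed.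

(** The sum over multiplicity functions factors into geometric series with n+1 terms; each of them
    times 1 - q^w is 1 - q^(w(n+1)), and w(n+1) > n. *)
Lemma fps_prod_geom (V : finType) (w : V -> nat) (n : nat) :
  (forall v, 0 < w v)%N ->
  fps_eqmod n
    ((\prod_v (1 - 'q ^+ w v)) *
     \sum_(c : {ffun V -> 'I_n.+1}) 'q ^+ (\sum_v c v * w v)) 1.
Proof.
move=> w0.
have -> : \sum_(c : {ffun V -> 'I_n.+1}) 'q ^+ (\sum_v c v * w v) =
    \prod_v \sum_(j < n.+1) (fpsq R ^+ w v) ^+ j.
  rewrite bigA_distr_bigA; apply: eq_bigr => c _.
  rewrite -prodrXr; apply: eq_bigr => v _.
  by rewrite mulnC exprM.
rewrite -big_split; apply: fps_eqmod_prod1 => v _ /=.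
rewrite -opprB mulNr -subrX1 opprB -exprM; apply: fps_eqmod_1subqX.
by rewrite mulnC leq_pmulr.
Qed.

(** Inverses are unique modulo q^(n+1), so [g] agrees up to degree [n] with the sum [A] over
    multiplicity functions. *)
Lemma coef_prod_geom (V : finType) (w : V -> nat) (n : nat) g :
  (forall v, 0 < w v)%N ->
  g * \prod_v (1 - 'q ^+ w v) = 1 -> g n = #|wpart w n|%:R.
Proof.
move=> w0 g1.
set A := \sum_(c : {ffun V -> 'I_n.+1}) fpsq R ^+ (\sum_v c v * w v).
transitivity (A n).
  rewrite -[RHS](_ : (g * (\prod_v (1 - 'q ^+ w v) * A)) n = _).
    rewrite -[in LHS](mulr1 g); apply: (@fps_eqmodM n) => // m le.
    by rewrite [RHS](fps_prod_geom w0).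
  by rewrite mulrA g1 mul1r.
rewrite fps_coef_sum -sum1_card natr_sum big_mkcond [RHS]big_mkcond /=.
by apply: eq_bigr => c _; rewrite fpsqXE inE eq_sym; case: eqP.
Qed.

End Series.

(** * Nonzero vectors of N^k by size, and the infinite product *)

(** The entries of a vector of size [r] are at most [r], so such vectors are the tuples counted by
    [card_ord_partitions]. *)
Lemma card_posmnm_mdeg (k n r : nat) : (0 < k)%N -> (0 < r <= n)%N ->
  #|[set v : posmnm k n | mdeg (val v) == r]| = 'C(r + k - 1, k - 1).
Proof.
case: k => // k _ /andP[r0 rn].
rewrite addnS !subn1 /= addnC -card_ord_partitions.
pose h (v : posmnm k.+1 n) := [tuple (inord (val (val v) i) : 'I_r.+1) | i < k.+1].
have le (v : posmnm k.+1 n) i : mdeg (val v) = r -> (val (val v) i < r.+1)%N.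
  by move=> <-; rewrite ltnS mdegE (bigD1 i) //= leq_addr.
rewrite -(card_in_imset (f := h)) => [|u v]; last first.
  rewrite !inE => /eqP du /eqP dv E; apply/val_inj/val_inj/mnmP => i /=.
  have := congr1 (fun t => val (tnth t i)) E; rewrite !tnth_mktuple /=.
  by rewrite !inordK // le.
congr #|pred_of_set _|; apply/setP => t; rewrite inE; apply/imsetP/idP.
  case=> v; rewrite inE => /eqP dv ->; rewrite big_tuple -[X in _ == X]dv mdegE.
  by apply/eqP/eq_bigr => i _; rewrite tnth_mktuple inordK // le.
rewrite big_tuple => /eqP dt; pose m := [multinom (tnth t i : nat) | i < k.+1].
have dm : mdeg m = r by rewrite mdegE -[RHS]dt; apply: eq_bigr => i _; rewrite mnmE.
have lm : (mdeg m < n.+1)%N by rewrite dm.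
have pm : (0 < mdeg (BMultinom lm))%N by rewrite /= dm.
exists (exist _ (BMultinom lm) pm); first by rewrite inE /= dm.
apply: eq_from_tnth => i; apply: val_inj.
by rewrite tnth_mktuple /= mnmE inordK.
Qed.

Lemma prod_posmnm (R : comNzRingType) (k n : nat) (F : nat -> R) : (0 < k)%N ->
  \prod_(v : posmnm k n) F (mdeg (val v)) =
  \prod_(1 <= r < n.+1) F r ^+ 'C(r + k - 1, k - 1).
Proof.
move=> k0; pose p (v : posmnm k n) : 'I_n.+1 := Ordinal (bmdeg (val v)).
rewrite (partition_big p (fun r => 0 < r)%N) => [|v _]; last exact: (valP v).
rewrite -(big_mkord (fun r => 0 < r)%N
  (fun r => \prod_(v : posmnm k n | mdeg (val v) == r) F (mdeg (val v)))).
rewrite big_ltn_cond // ltnn big_nat_cond [RHS]big_nat_cond.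
apply: eq_big => [r|r /andP[/andP[r0 rn] _]]; first by case: r.
rewrite -(@card_posmnm_mdeg k n r k0); last by rewrite r0 -ltnS.
rewrite cardsE -prodr_const; apply: eq_bigr => v /eqP <- //.
Qed.

(** Factors with r > n are 1 up to degree [n]; the others regroup into the inverse of a product over
    nonzero vectors of size at most [n]. *)
Lemma fps_infprod_posmnm (R : comNzRingType) (k : nat) : (0 < k)%N ->
  fps_infprod (fun r => 1 / (1 - 'q ^+ r) ^+ 'C(r + k - 1, k - 1))
    (FPS (fun n => #|wpart (fun v : posmnm k n => mdeg (val v)) n|%:R : R)).
Proof.
move=> k0 n; exists n => m lenm.
pose F r : fps R := (1 - 'q ^+ r) ^+ 'C(r + k - 1, k - 1).
have FU r : (0 < r)%N -> 1 / F r * F r = 1.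
  by move=> r0; rewrite mul1r mulVr // unitrX // fps_unit_1subqX.
rewrite (big_cat_nat (n := n.+1)) //=.
transitivity ((\prod_(1 <= r < n.+1) (1 / F r) * 1) n).
  apply: (@fps_eqmodM _ n) => //.
  rewrite big_nat_cond; apply: fps_eqmod_prod1 => r /andP[/andP[nr _] _].
  apply: fps_eqmod_inv (FU r _) _; first exact: leq_ltn_trans nr.
  (* The power is turned into a product of equal factors, each congruent to 1. *)
  rewrite /F -[X in _ ^+ X]card_ord -prodr_const.
  by apply: fps_eqmod_prod1 => _ _; apply: fps_eqmod_1subqX.
rewrite mulr1; apply: (@coef_prod_geom _ _ (fun v : posmnm k n => mdeg (val v))).
  by move=> v; exact: (valP v).
rewrite (prod_posmnm n (fun r => 1 - 'q ^+ r) k0) -big_split big_nat_cond big1 //=.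
by move=> r /andP[/andP[r0 _] _]; exact: FU.
Qed.

Lemma exists_sympow_coef (F : fieldType) (N r : nat) (G : 'X_{1..N} -> F) :
  exists p : sympow F N r, forall m,
    (mpoly_of_dhomog p)@_m = if mdeg m == r then G m else 0.
Proof.
pose q : {mpoly F[N]} :=
  \sum_(m : 'X_{1..N < r.+1} | mdeg m == r) G m *: 'X_[m].
have hq : q \is r.-homog.
  by apply: rpred_sum => m dm; apply: rpredZ; rewrite dhomogX.
exists (DHomog hq) => m /=; rewrite /q raddf_sum /=.
have [dm|dm] := eqVneq; last first.
  rewrite big1 // => u du; rewrite mcoeffZ mcoeffX.
  case: eqP => [E|]; last by rewrite mulr0.
  by case/negP: dm; rewrite -E.
have lm : (mdeg m < r.+1)%N by rewrite dm.
rewrite (bigD1 (BMultinom lm)) /= ?dm // mcoeffZ mcoeffX eqxx mulr1.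
rewrite big1 ?addr0 // => u /andP[_ nu]; rewrite mcoeffZ mcoeffX.
case: eqP => [E|]; last by rewrite mulr0.
by case/eqP: nu; apply: val_inj.
Qed.

(** * Multisets of vectors in N^k as sequences up to permutation *)

Section Dim.
Variable k : nat.
Implicit Types s t : seq 'X_{1..k}.

(** Entries of [s] are grouped by value; zero entries contribute nothing since [g] vanishes
    there. *)
Lemma sum_count_posmnm (r : nat) (g : 'X_{1..k} -> nat) s :
  g 0%MM = 0%N -> all (fun x => mdeg x <= r)%N s ->
  (\sum_(v : posmnm k r) count_mem (val (val v)) s * g (val (val v)))%N =
  (\sum_(x <- s) g x)%N.
Proof.
move=> g0; elim: s => [|x s IH] /=.
  by rewrite big_nil big1.
case/andP => dx /IH {}IH; rewrite big_cons -IH.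
under eq_bigr => v _ do rewrite mulnDl.
rewrite big_split /=; congr (_ + _)%N.
have [x0|x0] := posnP (mdeg x).
  have -> : x = 0%MM by apply/eqP; rewrite -mdeg_eq0 x0.
  rewrite g0 big1 // => v _; case: eqP => [E|//].
  by have := valP v; rewrite /= -E mdeg0.
pose v : posmnm k r := exist _ (BMultinom (dx : mdeg x < r.+1)%N) x0.
rewrite (bigD1 v) //= eqxx mul1n big1 ?addn0 // => u nuv.
case: eqP => [E|//]; case/eqP: nuv.
by apply/val_inj/val_inj.
Qed.

Lemma all_mdeg_le (r : nat) s : (\sum_(x <- s) mdeg x)%N = r ->
  all (fun x => mdeg x <= r)%N s.
Proof.
move=> <-; apply/allP => x xs.
by rewrite (big_rem x) //= leq_addr.
Qed.

(** Each occurrence of a nonzero vector adds at least 1 to the total size. *)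
Lemma count_posmnm_le (r : nat) s (v : posmnm k r) :
  (\sum_(x <- s) mdeg x)%N = r -> (count_mem (val (val v)) s < r.+1)%N.
Proof.
move=> dr; rewrite ltnS -[leqRHS]dr -(sum_count_posmnm (@mdeg0 k) (all_mdeg_le dr)).
rewrite (bigD1 v) //= (leq_trans _ (leq_addr _ _)) //.
by rewrite leq_pmulr //; exact: (valP v).
Qed.

(** Since the lengths agree, equal multiplicities of the nonzero vectors force equal multiplicities
    of zero. *)
Lemma perm_eq_posmnm (r : nat) s t : size s = size t ->
  (\sum_(x <- s) mdeg x)%N = r -> (\sum_(x <- t) mdeg x)%N = r ->
  (forall v : posmnm k r,
     count_mem (val (val v)) s = count_mem (val (val v)) t) ->
  perm_eq s t.
Proof.
move=> sst /all_mdeg_le ds /all_mdeg_le dt E.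
have E0 : count_mem 0%MM s = count_mem 0%MM t.
  pose g (x : 'X_{1..k}) : nat := x != 0%MM.
  have g0 : g 0%MM = 0%N by rewrite /g eqxx.
  have cg u : (\sum_(x <- u) g x)%N = count (predC (pred1 0%MM)) u.
    by rewrite -sum1_count [RHS]big_mkcond; apply: eq_bigr => x _; rewrite /g /=; case: eqP.
  have : (\sum_(x <- s) g x = \sum_(x <- t) g x)%N.
    rewrite -(sum_count_posmnm g0 ds) -(sum_count_posmnm g0 dt).
    by apply: eq_bigr => v _; rewrite E.
  rewrite !cg => /eqP.
  rewrite -(eqn_add2l (count_mem 0%MM s)) count_predC sst.
  by rewrite -(count_predC (pred1 0%MM) t) eqn_add2r => /eqP.
apply/allP => x; rewrite mem_cat => xst.
have dx : (mdeg x <= r)%N.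
  by case/orP: xst => [/(allP ds)|/(allP dt)].
have [x0|x0] := posnP (mdeg x).
  have -> : x = 0%MM by apply/eqP; rewrite -mdeg_eq0 x0.
  exact/eqP.
by have /= -> := E (exist _ (BMultinom (dx : mdeg x < r.+1)%N) x0).
Qed.

Lemma exists_seq_wpart (r n : nat) (c : {ffun posmnm k r -> 'I_r.+1}) :
  (r <= n)%N -> c \in wpart (fun v : posmnm k r => mdeg (val v)) r ->
  exists t : n.-tuple 'X_{1..k}, (\sum_(x <- t) mdeg x)%N = r /\
    forall v : posmnm k r, count_mem (val (val v)) t = c v.
Proof.
move=> rn; rewrite inE => /eqP cr.
pose l := flatten [seq nseq (c v) (val (val v) : 'X_{1..k}) |
                    v <- enum {: posmnm k r}].
have lsum (g : 'X_{1..k} -> nat) :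
    (\sum_(x <- l) g x = \sum_v c v * g (val (val v)))%N.
  rewrite big_flatten big_map big_enum; apply: eq_bigr => v _.
  by rewrite big_nseq iter_addn_0 mulnC.
(* Each listed vector has size at least 1, so there are at most [r] of them, and zeros can pad the
   list to length [n]. *)
have sl : (size l <= n)%N.
  rewrite -sum1_size lsum (leq_trans _ rn) // -[leqRHS]cr.
  by apply: leq_sum => v _; rewrite muln1 leq_pmulr //; exact: (valP v).
have st : size (l ++ nseq (n - size l) 0%MM) == n.
  by rewrite size_cat size_nseq subnKC.
exists (Tuple st) => /=; split=> [|v].
  by rewrite big_cat lsum big_nseq mdeg0 iter_addn_0 mul0n /= addn0.
rewrite count_cat count_nseq /=.
have /negPf -> : 0%MM != val (val v).
  by apply/eqP => E; have := valP v; rewrite /= -E mdeg0.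
rewrite mul0n addn0 -sum1_count big_mkcond (lsum (fun x => if pred1 _ x then 1 else 0)%N) /=.
rewrite (bigD1 v) //= eqxx muln1 big1 ?addn0 // => u nuv.
case: eqP => [E|]; last by rewrite muln0.
by case/eqP: nuv; apply/val_inj/val_inj.
Qed.

(** * Orbits of monomials under column permutations, and the dimension of the invariants *)

Section Columns.
Variable n : nat.
Implicit Types m : 'X_{1..k * n}.

Definition mnm_cols m : n.-tuple 'X_{1..k} :=
  [tuple [multinom m (mxtens_index (i, j)) | i < k] | j < n].

Lemma mnm_colsE m i j : tnth (mnm_cols m) j i = m (mxtens_index (i, j)).
Proof. by rewrite tnth_mktuple mnmE. Qed.

Lemma mnm_cols_surj (t : n.-tuple 'X_{1..k}) : exists m, mnm_cols m = t.
Proof.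
exists [multinom tnth t (mxtens_unindex a).2 (mxtens_unindex a).1 | a < k * n].
apply: eq_from_tnth => j; apply/mnmP => i.
by rewrite mnm_colsE mnmE mxtens_indexK.
Qed.

Lemma mdeg_cols m : (\sum_(x <- mnm_cols m) mdeg x)%N = mdeg m.
Proof.
rewrite big_tuple [RHS]mdegE.
rewrite (eq_bigr (fun j => \sum_i m (mxtens_index (i, j)))%N) => [|j _]; last first.
  by rewrite mdegE; apply: eq_bigr => i _; rewrite mnm_colsE.
rewrite exchange_big pair_big /= [RHS](reindex (@mxtens_index k n)) /=.
  by apply: eq_bigr => -[].
by exists (@mxtens_unindex k n) => a _; rewrite (mxtens_indexK, mxtens_unindexK).
Qed.

Lemma tens_perm_inj (s : 'S_n) : injective
  (fun a : 'I_(k * n) =>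
     mxtens_index ((mxtens_unindex a).1, s (mxtens_unindex a).2)).
Proof.
move=> a b; case: (mxtens_indexP a) (mxtens_indexP b) => i j [i' j'].
by rewrite !mxtens_indexK /= => /(can_inj (@mxtens_indexK _ _)) [-> /perm_inj ->].
Qed.

Definition tens_perm (s : 'S_n) : 'S_(k * n) := perm (@tens_perm_inj s).

Lemma tens_permE (s : 'S_n) i j :
  tens_perm s (mxtens_index (i, j)) = mxtens_index (i, s j).
Proof. by rewrite permE mxtens_indexK. Qed.

(** Row (i, j) of the Kronecker product has a single nonzero entry, a 1 in column (i, s j), so the
    substitution only renames variables. *)
Lemma symsubst_tens_perm (F : fieldType) (s : 'S_n) (p : {mpoly F[k * n]}) :
  symsubst (1%:M *t perm_mx s) p = msym (tens_perm s) p.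
Proof.
rewrite /symsubst /comp_mpoly /msym /mmap; apply: eq_bigr => m _; congr (_ * _).
apply: eq_bigr => a _; congr (_ ^+ _); rewrite tnth_mktuple /symvec.
rewrite (bigD1 (tens_perm s a)) //= big1 ?addr0 => [|b].
  case: (mxtens_indexP a) => i j; rewrite tens_permE mxE tensmxE !mxE !eqxx.
  by rewrite mulr1 scale1r.
case: (mxtens_indexP a) (mxtens_indexP b) => i j [i' j'].
rewrite tens_permE mxE tensmxE !mxE.
have [<-|] := eqVneq i i'; last by rewrite mul0r scale0r.
have [<-|] := eqVneq (s j) j'; first by rewrite eqxx.
by rewrite mulr0 scale0r.
Qed.


(** The group permutes the columns of monomials, so invariance means that coefficients are constant
    on orbits. *)
Lemma sympow_invP (F : fieldType) (r : nat) (p : sympow F (k * n) r) :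
  reflect (forall m m', perm_eq (mnm_cols m) (mnm_cols m') ->
             (mpoly_of_dhomog p)@_m = (mpoly_of_dhomog p)@_m')
    (p \in sympow_inv F k n r).
Proof.
apply: (iffP subv_bigcapP) => [inv m m' | inv s _].
  case/tuple_permP => s E; have /fixedSpaceP := inv s isT.
  move/(congr1 (@mpoly_of_dhomog _ _ _)).
  rewrite sympow_mxE symsubst_tens_perm => /(congr1 (mcoeff m')).
  rewrite mcoeff_sym => <-; congr (_@_ _); apply/mnmP => a.
  case: (mxtens_indexP a) => i j; rewrite mnmE tens_permE -!mnm_colsE.
  have -> : mnm_cols m = [tuple tnth (mnm_cols m') (s i) | i < n].
    exact: val_inj.
  by rewrite tnth_mktuple.
apply/fixedSpaceP/val_inj => /=; rewrite sympow_mxE symsubst_tens_perm.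
apply/mpolyP => m; rewrite mcoeff_sym; apply: inv.
apply/tuple_permP; exists s; congr val; apply: eq_from_tnth => j.
by apply/mnmP => i; rewrite mnm_colsE mnmE tens_permE tnth_mktuple mnm_colsE.
Qed.

(** A complete orbit invariant in degree [r]; there [inord] preserves the count by
    [count_posmnm_le]. *)
Definition mnm_type (r : nat) m : {ffun posmnm k r -> 'I_r.+1} :=
  [ffun v : posmnm k r => inord (count_mem (val (val v)) (mnm_cols m))].

Lemma perm_eq_mnm_type (r : nat) m m' : mdeg m = r -> mdeg m' = r ->
  mnm_type r m = mnm_type r m' -> perm_eq (mnm_cols m) (mnm_cols m').
Proof.
move=> dm dm' /ffunP E; apply: (@perm_eq_posmnm r); rewrite ?mdeg_cols //.
  by rewrite !size_tuple.
move=> v; have := congr1 val (E v); rewrite !ffunE /= !inordK //.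
  by apply: count_posmnm_le; rewrite mdeg_cols.
by apply: count_posmnm_le; rewrite mdeg_cols.
Qed.

Lemma mnm_type_perm_eq (r : nat) m m' :
  perm_eq (mnm_cols m) (mnm_cols m') -> mnm_type r m = mnm_type r m'.
Proof. by move=> /seq.permP E; apply/ffunP => v; rewrite !ffunE E. Qed.

Lemma mnm_type_wpart (r : nat) m : mdeg m = r ->
  mnm_type r m \in wpart (fun v : posmnm k r => mdeg (val v)) r.
Proof.
move=> dm; have dc := etrans (mdeg_cols m) dm; rewrite inE -[X in _ == X]dc.
rewrite -(sum_count_posmnm (@mdeg0 k) (all_mdeg_le dc)); apply/eqP.
by apply: eq_bigr => v _; rewrite ffunE inordK // count_posmnm_le.
Qed.

Lemma exists_mnm_type (r : nat) (c : {ffun posmnm k r -> 'I_r.+1}) :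
  (r <= n)%N -> c \in wpart (fun v : posmnm k r => mdeg (val v)) r ->
  exists m, mdeg m = r /\ mnm_type r m = c.
Proof.
move=> rn /(exists_seq_wpart rn)[t [dt ct]]; have [m mt] := mnm_cols_surj t.
exists m; split; first by rewrite -mdeg_cols mt.
by apply/ffunP => v; apply: val_inj; rewrite ffunE mt /= ct inord_val.
Qed.

(** When r <= n every multiset in [wpart] is the type of some monomial, so the types index the
    orbits and the count is free of [n]. *)
Lemma dim_sympow_inv (F : fieldType) (r : nat) : (r <= n)%N ->
  \dim (sympow_inv F k n r) =
  #|wpart (fun v : posmnm k r => mdeg (val v)) r|.
Proof.
move=> rn; set S := wpart _ _.
have /fin_all_exists[rep repP] : forall i : 'I_#|S|,
    exists m, mdeg m = r /\ mnm_type r m = enum_val i.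
  by move=> i; apply: exists_mnm_type => //; exact: enum_valP.
pose f (p : sympow F (k * n) r) : 'rV[F]_#|S| :=
  \row_i (mpoly_of_dhomog p)@_(rep i).
have f_lin : linear f.
  by move=> a p q; apply/rowP => i; rewrite !mxE /= mcoeffD mcoeffZ.
pose fL : {linear sympow F (k * n) r -> 'rV[F]_#|S|} :=
  HB.pack f (GRing.isLinear.Build F _ _ _ f f_lin).
(* Reading off the coefficients at one monomial per orbit is an isomorphism on
   the invariants. *)
rewrite -(@limg_dim_eq _ _ _ (linfun fL)).
  have -> : (linfun fL @: sympow_inv F k n r = fullv)%VS.
    apply/vspaceP => x; rewrite memvf; apply/memv_imgP.
    (* Surjectivity: the coefficient at [m] is the entry of [x] indexed by the type of [m]. *)
    have [p pE] := exists_sympow_coef r (fun m : 'X_{1..k * n} =>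
      \sum_(i < #|S|) (mnm_type r m == enum_val i)%:R * x 0 i).
    exists p; last first.
      apply/rowP => i; rewrite lfunE mxE /= pE.
      have [-> ->] := repP i; rewrite eqxx (bigD1 i) //= eqxx mul1r.
      rewrite big1 ?addr0 // => j nij.
      by rewrite (inj_eq enum_val_inj) eq_sym (negPf nij) mul0r.
    apply/sympow_invP => m m' mm'; rewrite !pE (mnm_type_perm_eq _ mm').
    by rewrite -(mdeg_cols m) (perm_big _ mm') mdeg_cols.
  by rewrite dimvf /dim /= mul1n.
(* Injectivity: each monomial of degree [r] shares its orbit, hence its coefficient, with a
   representative, where [p] vanishes. *)
apply/eqP; rewrite -subv0; apply/subvP => p /memv_capP[/sympow_invP inv].
rewrite memv_ker lfunE => /eqP /rowP f0.
rewrite memv0; apply/eqP/val_inj/mpolyP => m /=.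
rewrite mcoeff0; have [dm|dm] := eqVneq (mdeg m) r; last first.
  exact: dhomog_nemf_coeff (dhomog_is_dhomog p) dm.
have Sm := mnm_type_wpart dm.
have := f0 (enum_rank_in Sm (mnm_type r m)); rewrite !mxE => <-.
set i := enum_rank_in _ _; have [di ti] := repP i.
by apply: inv; apply: perm_eq_mnm_type dm di _; rewrite ti enum_rankK_in.
Qed.

End Columns.
End Dim.
Unset Implicit Arguments.

Theorem corollary2 (R : realType) (k : nat) (hk : (1 <= k)%N) :
  (forall r m n : nat, (r <= m)%N -> (m <= n)%N -> (1 <= m)%N ->
     \dim (sympow_inv R[i] k m r) = \dim (sympow_inv R[i] k n r))
  /\
  fps_infprod
    (fun r => 1 / (1 - 'q ^+ r) ^+ 'C(r + k - 1, k - 1))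
    (1 + FPS (fun n => if (1 <= n)%N
                       then (\dim (sympow_inv R[i] k n n))%:R : int else 0)).
Proof.
split=> [r m n rm mn _ | n].
  by rewrite !dim_sympow_inv // (leq_trans rm).
have [M MP] := fps_infprod_posmnm int hk n.
exists M => m /MP -> /=.
case: n {MP} => [|n]; last by rewrite dim_sympow_inv // add0r.
(* The constant term 1 counts the empty multiset: multiplicities lie in ['I_1], which leaves one
   function, of weight 0. *)
rewrite addr0; congr _%:R; rewrite -[RHS](exp1n #|{: posmnm k 0}|).
rewrite -[X in (X ^ _)%N](card_ord 1) -card_ffun -cardsT; congr #|pred_of_set _|; apply/setP => c.
by rewrite !inE big1 // => v _; rewrite ord1.
Qed.
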